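(* Let $q_1,q_2$ be positive integers. Then the Lie algebras $\mathcal{B}(q_1)$ and $\mathcal{B}(q_2)$ are isomorphic (as Lie algebras over $\mathbb{C}$) if and only if $q_1=q_2$.
   Context: $\mathbb{Z}_+$ denotes the set of nonnegative integers. For a positive integer $q$, $\mathcal{B}(q)$ is the complex Lie algebra with basis $\{L_{\alpha,i}\mid \alpha\in\mathbb{Z},\ i\in\mathbb{Z}_+\}$ and bracket $[L_{\alpha,i},L_{\beta,j}]=(\beta(i+q)-\alpha(j+q))L_{\alpha+\beta,i+j}$ for $\alpha,\beta\in\mathbb{Z}$, $i,j\in\mathbb{Z}_+$. *)

(* Defs.v *)
From HB Require Import structures.
From mathcomp Require Import all_boot all_order all_algebra finmap.
From mathcomp Require Import complex ring.
From mathcomp Require Import reals.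
From mathcomp.multinomials Require Import monalg.

Set Implicit Arguments.
Unset Strict Implicit.
Unset Printing Implicit Defensive.

Import Order.TTheory GRing.Theory Num.Theory.
Local Open Scope ring_scope.

HB.mixin Record isLieAlgebra (K : fieldType) V of GRing.Lmodule K V := {
  lie : V -> V -> V;
  lie_linearl : forall v, linear (lie^~ v);
  lie_linearr : forall u, linear (lie u);
  lie_alt : forall u, lie u u = 0;
  lie_jacobi : forall u v w,
    lie u (lie v w) + lie v (lie w u) + lie w (lie u v) = 0
}.

#[short(type="lieAlgType")]
HB.structure Definition LieAlgebra (K : fieldType) :=
  { V of isLieAlgebra K V & GRing.Lmodule K V }.

Definition lie_isomorphic (K : fieldType) (U V : lieAlgType K) : Prop :=
  exists f : {linear U -> V}, bijective f /\ {morph f : u v / lie u v}.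

(* The linear extension to the free module {malg K[X]} of a map given on the
   basis X. *)
Definition lin_ext (K : comNzRingType) (X : choiceType) (V : lmodType K)
  (h : X -> V) (f : {malg K[X]}) : V := \sum_(x <- msupp f) f@_x *: h x.

Lemma lin_extEw (K : comNzRingType) (X : choiceType) (V : lmodType K)
  (h : X -> V) (f : {malg K[X]}) (d : {fset X}) :
  (msupp f `<=` d)%fset -> lin_ext h f = \sum_(x <- d) f@_x *: h x.
Proof.
move=> le_d; rewrite /lin_ext (big_fset_incl _ le_d) //= => x _.
by move/mcoeff_outdom => ->; rewrite scale0r.
Qed.

Lemma lin_ext_linear (K : comNzRingType) (X : choiceType) (V : lmodType K)
  (h : X -> V) : linear (lin_ext h).
Proof.
move=> c f g; pose d := (msupp f `|` msupp g)%fset.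
have lef : (msupp f `<=` d)%fset by apply: fsubsetUl.
have leg : (msupp g `<=` d)%fset by apply: fsubsetUr.
have lefg : (msupp (c *: f + g) `<=` d)%fset.
  apply: fsubset_trans (msuppD_le _ _) _.
  by rewrite fsetSU // msuppZ_le.
rewrite (lin_extEw _ lef) (lin_extEw _ leg) (lin_extEw _ lefg).
rewrite scaler_sumr -big_split /=; apply: eq_bigr => x _.
by rewrite mcoeffD mcoeffZ scalerDl scalerA.
Qed.

HB.instance Definition _ (K : comNzRingType) (X : choiceType) (V : lmodType K)
  (h : X -> V) :=
  GRing.isLinear.Build K {malg K[X]} V *:%R (lin_ext h) (lin_ext_linear h).

Lemma lin_extU (K : comNzRingType) (X : choiceType) (V : lmodType K)
  (h : X -> V) (x : X) : lin_ext h << x >> = h x.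
Proof.
by rewrite (lin_extEw _ msuppU_le) big_seq_fset1 mcoeffUU scale1r.
Qed.

Lemma malg_sumU (K : comNzRingType) (X : choiceType) (f : {malg K[X]}) :
  f = \sum_(x <- msupp f) f@_x *: << x >>.
Proof.
rewrite [LHS]monalgE; apply: eq_bigr => x _; apply/malgP => y.
by rewrite mcoeffZ !mcoeffU mulrnAr mulr1.
Qed.

Lemma malg_linear_ext (K : comNzRingType) (X : choiceType) (V : lmodType K)
  (S T : {malg K[X]} -> V) : linear S -> linear T ->
  (forall x, S << x >> = T << x >>) -> S =1 T.
Proof.
move=> Sl Tl ST f.
pose S' := GRing.isLinear.Build _ _ _ _ S Sl.
pose T' := GRing.isLinear.Build _ _ _ _ T Tl.
pose SL : {linear {malg K[X]} -> V} := HB.pack S S'.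
pose TL : {linear {malg K[X]} -> V} := HB.pack T T'.
rewrite -[S]/(SL : _ -> _) -[T]/(TL : _ -> _) (malg_sumU f) !linear_sum.
by apply: eq_bigr => x _; rewrite !linearZ; congr (_ *: _); exact: ST.
Qed.

(* The free module on Z x Z_+, i.e. the finitely supported functions
   int * nat -> R[i]; the parameter q only selects the bracket put on it. *)
Definition blockLie (R : realType) (q : nat) : Type :=
  {malg R[i][(int * nat)%type]}.

HB.instance Definition _ (R : realType) (q : nat) :=
  GRing.Lmodule.on (blockLie R q).

Definition blockL (R : realType) (q : nat) (x : int * nat) : blockLie R q :=
  << x >>.

Definition block_coef (q : nat) (x y : int * nat) : int :=
  y.1 * (x.2 + q)%:Z - x.1 * (y.2 + q)%:Z.

Definition block_add (x y : int * nat) : int * nat :=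
  (x.1 + y.1, (x.2 + y.2)%N).

Definition block_ad (R : realType) (q : nat) (x : int * nat) :
  blockLie R q -> blockLie R q :=
  lin_ext (fun y => (block_coef q x y)%:~R *: blockL R q (block_add x y)).

Definition block_bracket (R : realType) (q : nat) (f g : blockLie R q) :
  blockLie R q := lin_ext (fun x => block_ad x g) f.

Lemma block_linearl (R : realType) (q : nat) (g : blockLie R q) :
  linear ((@block_bracket R q)^~ g).
Proof. exact: lin_ext_linear. Qed.

Lemma block_linearr (R : realType) (q : nat) (f : blockLie R q) :
  linear (block_bracket f).
Proof.
move=> c g h; rewrite /block_bracket /lin_ext scaler_sumr -big_split /=.
apply: eq_bigr => x _; rewrite /block_ad linearP scalerDr.
by rewrite !scalerA mulrC.
Qed.

HB.instance Definition _ (R : realType) (q : nat) (f : blockLie R q) :=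
  GRing.isLinear.Build (R[i]) (blockLie R q) (blockLie R q) *:%R
    (block_bracket f) (block_linearr f).

Lemma block_bracketL (R : realType) (q : nat) (x y : int * nat) :
  block_bracket (blockL R q x) (blockL R q y) =
  (block_coef q x y)%:~R *: blockL R q (block_add x y).
Proof. by rewrite /block_bracket lin_extU /block_ad lin_extU. Qed.

Lemma block_addC : commutative block_add.
Proof. by move=> [a i] [b j]; rewrite /block_add /= addrC addnC. Qed.

Lemma block_addA : associative block_add.
Proof. by move=> [a i] [b j] [c k]; rewrite /block_add /= addrA addnA. Qed.

Lemma block_coefC (q : nat) (x y : int * nat) :
  block_coef q y x = - block_coef q x y.
Proof. by rewrite /block_coef opprB. Qed.

Lemma block_coef_jacobi (q : nat) (x y z : int * nat) :
  block_coef q y z * block_coef q x (block_add y z) +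
  block_coef q z x * block_coef q y (block_add z x) +
  block_coef q x y * block_coef q z (block_add x y) = 0.
Proof. by rewrite /block_coef /= !PoszD; ring. Qed.

Lemma block_anticomm (R : realType) (q : nat) (f g : blockLie R q) :
  block_bracket g f = - block_bracket f g.
Proof.
apply: (malg_linear_ext (S := (@block_bracket R q)^~ f)
                        (T := fun g => - block_bracket f g)) => [||y].
- exact: block_linearl.
- by move=> c u v; rewrite block_linearr opprD scalerN.
apply: (malg_linear_ext (S := @block_bracket R q << y >>)
                        (T := fun f => - block_bracket f << y >>)) => [||x].
- exact: block_linearr.
- by move=> c u v; rewrite block_linearl opprD scalerN.
rewrite -!/(blockL R q _) !block_bracketL block_coefC block_addC.
by rewrite rmorphN scaleNr.
Qed.

Lemma block_alt (R : realType) (q : nat) (f : blockLie R q) :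
  block_bracket f f = 0.
Proof.
have /eqP := block_anticomm f f.
rewrite -subr_eq0 opprK -mulr2n -scaler_nat scaler_eq0 pnatr_eq0 /=.
by move/eqP.
Qed.

Lemma addr3ACA (V : zmodType) (a b c a' b' c' : V) :
  a + a' + (b + b') + (c + c') = a + b + c + (a' + b' + c').
Proof. by rewrite (addrACA a) (addrACA (a + b)). Qed.

Lemma addr3rot (V : zmodType) (a b c : V) : a + b + c = b + c + a.
Proof. by rewrite -addrA addrC. Qed.

Lemma block_jacobi (R : realType) (q : nat) (f g h : blockLie R q) :
  block_bracket f (block_bracket g h) + block_bracket g (block_bracket h f) +
  block_bracket h (block_bracket f g) = 0.
Proof.
pose J (f g h : blockLie R q) := block_bracket f (block_bracket g h) +
  block_bracket g (block_bracket h f) + block_bracket h (block_bracket f g).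
have J1 u v : linear (fun f => J f u v).
  move=> c a b; rewrite /J block_linearl !block_linearr block_linearl.
  rewrite block_linearr !scalerDr.
  exact: addr3ACA.
have Jrot u v w : J u v w = J v w u by exact: addr3rot.
have J0 : linear (fun _ : blockLie R q => 0 : blockLie R q).
  by move=> c u v; rewrite scaler0 addr0.
rewrite -/(J f g h); move: f; apply: (malg_linear_ext (J1 g h) J0) => x.
rewrite Jrot; move: g; apply: (malg_linear_ext (J1 h << x >>) J0) => y.
rewrite Jrot; move: h; apply: (malg_linear_ext (J1 << x >> << y >>) J0) => z.
rewrite Jrot /J -!/(blockL R q _) !block_bracketL.
have E u (a : int) v : block_bracket (blockL R q u) (a%:~R *: blockL R q v) =
    (a * block_coef q u v)%:~R *: blockL R q (block_add u v).
  by rewrite linearZ /= block_bracketL scalerA intrM.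
have Ey : block_add y (block_add z x) = block_add x (block_add y z).
  by rewrite block_addA block_addC.
have Ez : block_add z (block_add x y) = block_add x (block_add y z).
  by rewrite block_addC block_addA.
rewrite !E Ey Ez.
rewrite -!scalerDl -!intrD.
by rewrite block_coef_jacobi scale0r.
Qed.

HB.instance Definition _ (R : realType) (q : nat) :=
  isLieAlgebra.Build (R[i]) (blockLie R q) (@block_linearl R q)
    (@block_linearr R q) (@block_alt R q) (@block_jacobi R q).

Lemma lie_blockL (R : realType) (q : nat) (a b : int) (i j : nat) :
  lie (blockL R q (a, i)) (blockL R q (b, j)) =
  (b * (i + q)%:Z - a * (j + q)%:Z)%:~R *: blockL R q (a + b, (i + j)%N).
Proof. exact: block_bracketL. Qed.

(* Main.v *)
From HB Require Import structures.
Require Import Defs.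
From mathcomp Require Import all_boot all_order all_algebra finmap.
From mathcomp Require Import complex reals ring zify.
From mathcomp.multinomials Require Import monalg.

(** If q1 = q2 the identity is an isomorphism.  Conversely, let f be an
    isomorphism from B(q1) to B(q2); it is enough to show that q1 divides q2,
    because the inverse of f then gives the other divisibility.

    The element L_{0,0} spans the elements x for which ad x is locally finite.
    On the one hand ad L_{0,0} is diagonal, with eigenvalue a q on L_{a,i}, so
    every vector is killed by a product of factors ad L_{0,0} - c
    ([ad_locally_finite00]).  On the other hand, an x with a term L_{a,i},
    (a, i) <> (0, 0), has, for a suitable monomial order, a leading degree
    above (0, 0); the vectors (ad x)^n L_{b,0}, for well-chosen b, then have
    strictly growing leading degrees, and no such product kills L_{b,0}
    ([ad_locally_finite_supp]).  Being locally finite is invariant under f,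
    hence f L_{0,0} = c L_{0,0}.  Comparing eigenvalues, f sends the span of
    the L_{a,i}, i >= 0, into the span of the L_{ab,i} for one integer b with
    c b q2 = q1 ([iso_graded]).

    The span of the L_{a,i} is identified with the polynomials p(t) through
    t^i <-> L_{a,i}.  With E = t d/dt, the bracket of p in degree b and r in
    degree -b is then -b (E + 2q)(p r) in degree 0, and u in degree 0 acts on
    degree b by multiplication by b (E + q) u.  Let g, h, u be the polynomials
    of f L_{1,0}, f L_{-1,0}, f L_{0,1}.
    - From [L_{1,0}, L_{-1,0}] = -2 q1 L_{0,0}, the polynomial (E + 2 q2)(g h)
      is constant; so g h is a constant k, and b^2 k = (q1 / q2)^2.
    - From [[L_{0,1}, L_{1,0}], L_{-1,0}] = - (1 + q1) (1 + 2 q1) L_{0,1},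
      b^2 k (E + 2 q2) (E + q2) u = (1 + q1) (1 + 2 q1) u.
    If t^d occurs in u, the last equation at t^d reads
    (d/q2 + 1) (d/q2 + 2) = (1/q1 + 1) (1/q1 + 2), whence d q1 = q2
    ([iso_dvdn]). *)

Set Implicit Arguments.
Unset Strict Implicit.
Unset Printing Implicit Defensive.

Import Order.TTheory GRing.Theory Num.Theory.
Local Open Scope ring_scope.

(** * Monomial orders on the degrees *)

(** The lexicographic order on (s a, i).  For both signs of s it is compatible
    with the addition of degrees; the sign is kept free because the degree
    that has to dominate may have a > 0 or a < 0. *)
Definition deg_le (s : int) (x y : int * nat) : bool :=
  (s * x.1 < s * y.1) || (s * x.1 == s * y.1) && (x.2 <= y.2)%N.

Lemma deg_le_refl s : reflexive (deg_le s).
Proof. by move=> x; rewrite /deg_le eqxx leqnn orbT. Qed.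

Lemma deg_le_total s : total (deg_le s).
Proof. by move=> x y; rewrite /deg_le; lia. Qed.

Lemma deg_le_trans s : transitive (deg_le s).
Proof. by move=> y x z; rewrite /deg_le; lia. Qed.

Lemma deg_leD s x y a b : deg_le s x a -> deg_le s y b ->
  deg_le s (block_add x y) (block_add a b).
Proof. by rewrite /deg_le /block_add /= !mulrDr; lia. Qed.

Lemma deg_leD_eq s x y a b : s != 0 -> deg_le s x a -> deg_le s y b ->
  block_add x y = block_add a b -> (x == a) && (y == b).
Proof.
case: x y a b => [x i] [y j] [a k] [b l] s0.
rewrite /deg_le /block_add /= => hx hy [e1 e2].
have /eqP: s * (x + y) == s * (a + b) by rewrite e1.
rewrite !mulrDr => e3.
have /(mulfI s0) ex : s * x = s * a by lia.
have /(mulfI s0) ey : s * y = s * b by lia.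
have [ei ej] : i = k /\ j = l by lia.
by rewrite ex ey ei ej !eqxx.
Qed.

Lemma total_max (T : eqType) (r : rel T) (l : seq T) z :
  reflexive r -> total r -> transitive r -> z \in l ->
  exists2 a, a \in l & {in l, forall x, r x a}.
Proof.
move=> rr rt rtr; elim: l z => [//|y l IH] z _.
case: l IH => [|w l] IH.
  by exists y => [|x]; rewrite ?inE// => /eqP->.
have [a al ha] := IH w (mem_head _ _).
case/orP: (rt a y) => h.
  exists y; first exact: mem_head.
  move=> x; rewrite in_cons => /orP[/eqP->|/ha xa]; first exact: rr.
  exact: rtr xa h.
exists a; first by rewrite in_cons al orbT.
by move=> x; rewrite in_cons => /orP[/eqP->|/ha].
Qed.

(** * Locally finite adjoint actions *)

Section Block.
Variables (R : realType) (q : nat).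
Implicit Types (u v : blockLie R q) (x y z : int * nat).

Lemma lie_coef u v z :
  (lie u v)@_z = \sum_(x <- msupp u) \sum_(y <- msupp v)
     u@_x * v@_y * (block_coef q x y)%:~R * (block_add x y == z)%:R.
Proof.
rewrite [lie u v]/(block_bracket u v) /block_bracket /block_ad /lin_ext.
rewrite raddf_sum /=; apply: eq_bigr => x _.
rewrite mcoeffZ raddf_sum /= mulr_sumr; apply: eq_bigr => y _.
by rewrite !mcoeffZ mcoeffU !mulrA.
Qed.

Lemma lie00_coef v x :
  (lie (blockL R q (0, 0%N)) v)@_x = (x.1 * q%:Z)%:~R * v@_x.
Proof.
pose S w := (lie (blockL R q (0, 0%N)) w)@_x : (R[i])^o.
pose T (w : blockLie R q) := (x.1 * q%:Z)%:~R * w@_x : (R[i])^o.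
have Sl : linear S by move=> c a b; rewrite /S lie_linearr mcoeffD mcoeffZ.
have Tl : linear T.
  by move=> c a b; rewrite /T mcoeffD mcoeffZ mulrDr mulrCA.
apply: (malg_linear_ext Sl Tl) => -[b j] {Sl Tl}; rewrite {}/S {}/T.
rewrite -/(blockL R q (b, j)) lie_blockL add0r !add0n mul0r subr0.
rewrite mcoeffZ mcoeffU.
by case: eqP => [<-//|_]; rewrite !mulr0.
Qed.

Lemma lie_supp u v z : (lie u v)@_z != 0 ->
  exists x y, [/\ u@_x != 0, v@_y != 0 & z = block_add x y].
Proof.
move=> h; suff /hasP[x xu /hasP[y yv /eqP<-]] : has (fun x => has (fun y =>
    block_add x y == z) (msupp v)) (msupp u).
  by exists x, y; rewrite !mcoeff_neq0.
apply: contraNT h => /hasPn h; rewrite lie_coef.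
rewrite big_seq big1 // => x /h /hasPn g.
by rewrite big_seq big1 // => y /g /negPf ->; rewrite mulr0.
Qed.

Definition leading s u a :=
  u@_a != 0 /\ forall x, u@_x != 0 -> deg_le s x a.

Lemma leading_exists s u z : u@_z != 0 ->
  exists2 a, leading s u a & deg_le s z a.
Proof.
rewrite mcoeff_neq0 => zu.
have [a au ha] := total_max (@deg_le_refl s) (@deg_le_total s)
  (@deg_le_trans s) zu.
exists a; last exact: ha.
by split=> [|x]; rewrite mcoeff_neq0 //; apply: ha.
Qed.

(** The leading degree of a sum of degrees is reached only by the pair of
    leading degrees, so the leading coefficients do not interfere with any
    other term of the bracket. *)
Lemma lie_leading s u v a b : s != 0 -> leading s u a -> leading s v b ->
  (lie u v)@_(block_add a b) = u@_a * v@_b * (block_coef q a b)%:~R.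
Proof.
move=> s0 [ua ha] [vb hb]; rewrite lie_coef.
rewrite (bigD1_seq a) ?fset_uniq -?mcoeff_neq0 //=.
rewrite (bigD1_seq b) ?fset_uniq -?mcoeff_neq0 //= eqxx mulr1.
rewrite big_seq_cond big1 ?addr0 => [|y /andP[yv yb]].
  rewrite big_seq_cond big1 ?addr0 // => x /andP[xu xa].
  rewrite big_seq big1 // => y yv; case: eqP; rewrite ?mulr0//.
  rewrite -mcoeff_neq0 in xu; rewrite -mcoeff_neq0 in yv.
  move=> /(deg_leD_eq s0 (ha _ xu) (hb _ yv)) /andP[xa' _].
  by rewrite xa' in xa.
case: eqP; rewrite ?mulr0//.
rewrite -mcoeff_neq0 in yv.
move=> /(deg_leD_eq s0 (ha _ ua) (hb _ yv)) /andP[_ yb'].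
by rewrite yb' in yb.
Qed.

(** The product over c in l of the operators ad u - c, applied to v. *)
Definition ad_prod u (l : seq R[i]) v :=
  foldr (fun c w => lie u w - c *: w) v l.

(** If u has leading degree a above (0, 0), ad u raises the leading degree of v
    from b to a + b as soon as block_coef q a b <> 0, and the term c v is too
    low to interfere.  The positivity hypothesis on block_coef q a b persists
    when b is replaced by a + b, which is what makes the step repeatable. *)
Lemma leading_ad_prod s u a v b l : s != 0 -> leading s u a ->
  ~~ deg_le s a (0, 0%N) -> leading s v b -> 0 < s * block_coef q a b ->
  exists2 b', leading s (ad_prod u l v) b' & 0 < s * block_coef q a b'.
Proof.
move=> s0 ua apos vb ab; elim: l => [|c l [d wd ad]]; first by exists b.
set w := ad_prod u l v in wd *; exists (block_add a d); last first.
  move: ad apos; case: a {ua ab} d {wd} => [a i] [d j].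
  rewrite /block_coef /deg_le /block_add /= PoszD; nia.
have dlt : ~~ deg_le s (block_add a d) d.
  by move: apos; rewrite /deg_le /block_add /= !mulrDr; lia.
split=> [|x] /=; rewrite -/w.
  rewrite mcoeffB mcoeffZ (lie_leading s0 ua wd).
  have -> : w@_(block_add a d) = 0.
    by apply/eqP; apply: contraNT dlt; apply: (proj2 wd).
  rewrite mulr0 subr0 !mulf_neq0 ?intr_eq0 ?(proj1 ua) ?(proj1 wd) //.
  by apply: contraTneq ad => ->; rewrite mulr0.
rewrite mcoeffB mcoeffZ => h.
have [lx|/lie_supp[y [z [hy hz ->]]]] := eqVneq (lie u w)@_x 0; last first.
  by apply: deg_leD; [apply: (proj2 ua)|apply: (proj2 wd)].
have : w@_x != 0 by apply: contraNneq h => ->; rewrite lx mulr0 subr0.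
move=> /(proj2 wd) xd; apply: deg_le_trans xd _.
by case/orP: (deg_le_total s d (block_add a d)) => // h'; rewrite h' in dlt.
Qed.

Lemma leading_blockL s b : leading s (blockL R q b) b.
Proof.
split=> [|x]; first by rewrite mcoeffUU oner_neq0.
by rewrite mcoeffU; case: (b =P x) => [->|_]; rewrite ?deg_le_refl ?eqxx.
Qed.

(** Local finiteness of ad u is expressed without finite-dimensional
    subspaces: each vector is killed by some product of factors ad u - c. *)
Lemma ad_locally_finite_supp u : (0 < q)%N ->
  (forall v, exists l, ad_prod u l v = 0) ->
  forall z, z != (0, 0%N) -> u@_z = 0.
Proof.
move=> q0 fin z z0; apply/eqP/negPn/negP => uz.
have [s [s1 zpos]] : exists s : int, `|s| = 1 /\ ~~ deg_le s z (0, 0%N).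
  case: z z0 {uz} => [a i] z0.
  exists (if a < 0 then -1 else 1); split; first by case: ifP.
  move: z0; rewrite /deg_le /= xpair_eqE.
  by case: ifP; rewrite ?mul1r ?mulN1r; lia.
have s0 : s != 0 by rewrite -normr_gt0 s1.
have [a ua za] := leading_exists s uz.
have apos : ~~ deg_le s a (0, 0%N).
  by apply: contra zpos; apply: deg_le_trans.
(* This b makes [s * block_coef q a b] positive: the value is
   (1 + m q) (i + q) - m q, where m = s * a.1 >= 0 and i = a.2. *)
pose b : int * nat := (s * (1 + s * a.1 * q%:Z), 0%N).
have ab : 0 < s * block_coef q a b.
  have ss : s * s = 1 by lia.
  have -> : s * block_coef q a b =
      (s * s) * (1 + s * a.1 * q%:Z) * (a.2 + q)%:Z - s * a.1 * q%:Z.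
    by rewrite /block_coef /b /= add0n; ring.
  move: apos; rewrite ss /deg_le /= mulr0; nia.
have [l hl] := fin (blockL R q b).
have [b' [hb _] _] := leading_ad_prod l s0 ua apos (leading_blockL s b) ab.
by rewrite hl mcoeff0 eqxx in hb.
Qed.

(** The list of factors consists of the eigenvalues of ad L_{0,0} at the
    degrees that occur in u. *)
Lemma ad_locally_finite00 u : exists l, ad_prod (blockL R q (0, 0%N)) l u = 0.
Proof.
exists [seq (x.1 * q%:Z)%:~R | x <- enum_fset (msupp u)].
apply/malgP => x; rewrite mcoeff0.
have E l : (ad_prod (blockL R q (0, 0%N)) l u)@_x =
    (\prod_(c <- l) ((x.1 * q%:Z)%:~R - c)) * u@_x.
  elim: l => [|c l IH]; first by rewrite big_nil mul1r.
  by rewrite big_cons /= mcoeffB mcoeffZ lie00_coef -mulrBl IH mulrA.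
rewrite E; have [->|] := eqVneq (u@_x) 0; first by rewrite mulr0.
rewrite mcoeff_neq0 => xu.
by rewrite big_map (big_rem x) //= subrr !mul0r.
Qed.

End Block.

(** * Polynomial description of the graded pieces *)

Lemma poly_linear_ext (K : comNzRingType) (V : lmodType K)
    (S T : {poly K} -> V) :
  linear S -> linear T -> (forall i, S 'X^i = T 'X^i) -> S =1 T.
Proof.
move=> Sl Tl ST p.
pose SL : {linear {poly K} -> V} :=
  HB.pack S (GRing.isLinear.Build _ _ _ _ S Sl).
pose TL : {linear {poly K} -> V} :=
  HB.pack T (GRing.isLinear.Build _ _ _ _ T Tl).
rewrite -[S]/(SL : _ -> _) -[T]/(TL : _ -> _) -[p]coefK poly_def !linear_sum.
by apply: eq_bigr => i _; rewrite !linearZ; congr (_ *: _); exact: ST.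
Qed.

(** The operator E + m, where E = t d/dt is the Euler operator. *)
Definition euler (K : comNzRingType) (m : nat) (p : {poly K}) : {poly K} :=
  'X * p^`() + m%:R *: p.

Lemma euler_linear (K : comNzRingType) (m : nat) : linear (@euler K m).
Proof.
move=> c p r; rewrite /euler derivD derivZ mulrDr -scalerAr !scalerDr.
by rewrite !scalerA [m%:R * c]mulrC addrACA.
Qed.

HB.instance Definition _ (K : comNzRingType) (m : nat) :=
  GRing.isLinear.Build K {poly K} {poly K} *:%R (@euler K m)
    (@euler_linear K m).

Lemma coef_euler (K : comNzRingType) m (p : {poly K}) i :
  (euler m p)`_i = (i + m)%:R * p`_i.
Proof.
rewrite coefD coefZ coefXM natrD mulrDl; congr (_ + _).
by case: i => [|i]; rewrite ?mul0r //= coef_deriv mulr_natl.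
Qed.

Lemma eulerM (K : comNzRingType) m n (p r : {poly K}) :
  euler (m + n) (p * r) = euler m p * r + p * euler n r.
Proof. by rewrite /euler derivM -!mul_polyC natrD polyCD; ring. Qed.

Section Rows.
Variables (R : realType) (q : nat).
Implicit Types (u v : blockLie R q) (p r : {poly R[i]}).

Definition row b p : blockLie R q :=
  \sum_(i < size p) p`_i *: blockL R q (b, i : nat).

Lemma row_coef b p x : (row b p)@_x = p`_(x.2) *+ (b == x.1).
Proof.
case: x => a k; rewrite raddf_sum /=.
under eq_bigr => i _ do rewrite mcoeffZ mcoeffU xpair_eqE.
case: eqP => _ /=; last by rewrite big1 // => i _; rewrite mulr0.
have [ks|ks] := ltnP k (size p).
  rewrite (bigD1 (Ordinal ks)) //= eqxx mulr1 big1 ?addr0 // => i.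
  by rewrite -val_eqE /= => /negPf->; rewrite mulr0.
rewrite nth_default // big1 // => i _.
by rewrite ltn_eqF ?mulr0// (leq_trans (ltn_ord i)).
Qed.

Lemma row_linear b : linear (row b).
Proof.
move=> c p r; apply/malgP => x.
by rewrite mcoeffD mcoeffZ !row_coef coefD coefZ mulrnDl mulrnAr.
Qed.

HB.instance Definition _ b :=
  GRing.isLinear.Build R[i] {poly R[i]} (blockLie R q) *:%R (row b)
    (row_linear b).

Lemma row_inj b : injective (row b).
Proof.
move=> p r e; apply/polyP => i.
by have := congr1 (mcoeff (b, i)) e; rewrite !row_coef eqxx.
Qed.

Lemma rowXn b i : row b 'X^i = blockL R q (b, i).
Proof.
apply/malgP => -[a j]; rewrite row_coef mcoeffU coefXn xpair_eqE /=.
by rewrite -mulrnA mulnb andbC [j == i]eq_sym.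
Qed.

Lemma row_of b v : (forall x, x.1 != b -> v@_x = 0) -> exists p, v = row b p.
Proof.
move=> hv; pose n := \max_(x <- msupp v) x.2.
exists (\poly_(i < n.+1) v@_(b, i)); apply/malgP => -[a i].
rewrite row_coef coef_poly /=; case: eqP => [<-|/eqP ba].
  case: ltnP => // ni; apply/eqP; apply: contraTT ni.
  by rewrite mcoeff_neq0 -leqNgt => /leq_bigmax_seq; apply.
by apply: hv => /=; apply: contra ba => /eqP->.
Qed.

(** Both sides are bilinear, so this is the defining bracket read on
    monomials. *)
Lemma lie_row b c p r :
  lie (row b p) (row c r) =
  row (b + c) (c%:~R *: (euler q p * r) - b%:~R *: (p * euler q r)).
Proof.
pose S p r := lie (row b p) (row c r).
pose T p r :=
  row (b + c) (c%:~R *: (euler q p * r) - b%:~R *: (p * euler q r)).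
rewrite -/(S p r) -/(T p r).
move: p; apply: poly_linear_ext => [k p p'|k p p'|i].
- by rewrite /S linearP lie_linearl.
- rewrite /T -linearP; congr (row _ _) => /=; rewrite linearP /=.
  by rewrite -!mul_polyC; ring.
move: r; apply: poly_linear_ext => [k r r'|k r r'|j].
- by rewrite /S linearP lie_linearr.
- rewrite /T -linearP; congr (row _ _) => /=; rewrite linearP /=.
  by rewrite -!mul_polyC; ring.
have eX m k : euler m 'X^k = (k + m)%:R *: 'X^k :> {poly R[i]}.
  apply/polyP => l; rewrite coef_euler coefZ coefXn.
  by case: eqP => [->|]; rewrite ?mulr0.
rewrite /S /T !rowXn lie_blockL -rowXn -linearZ; congr (row _ _) => /=.
rewrite !eX -scalerAl -scalerAr -exprD !scalerA -scalerBl; congr (_ *: _).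
by rewrite rmorphB /= !rmorphM.
Qed.

Lemma lie_row_opp b p r :
  lie (row b p) (row (- b) r) = row 0 (- b%:~R *: euler (q + q) (p * r)).
Proof.
rewrite lie_row subrr; congr (row _ _).
by rewrite eulerM rmorphN !scaleNr /= scalerDr opprD.
Qed.

Lemma lie_row0 b p r :
  lie (row 0 p) (row b r) = row b (b%:~R *: (euler q p * r)).
Proof. by rewrite lie_row add0r scale0r subr0. Qed.

End Rows.

(** * The structure of an isomorphism *)

(** The function x |-> (x + 1) (x + 2) is injective on x >= 0; here it takes the
    same value at d / q2 and at 1 / q1. *)
Lemma ratio_unique (q1 q2 d : nat) : (0 < q1)%N -> (0 < q2)%N ->
  (q1 ^ 2 * ((d + q2) * (d + 2 * q2)) = q2 ^ 2 * ((1 + q1) * (1 + 2 * q1)))%N ->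
  (d * q1 = q2)%N.
Proof.
move=> q1_gt0 q2_gt0 e.
have /eqP : (d%:Z * q1%:Z - q2%:Z) *
    (d%:Z * q1%:Z + q2%:Z + 3 * q1%:Z * q2%:Z) = 0.
  have {}e : q1%:Z ^+ 2 * ((d%:Z + q2%:Z) * (d%:Z + 2 * q2%:Z)) -
      q2%:Z ^+ 2 * ((1 + q1%:Z) * (1 + 2 * q1%:Z)) = 0 by lia.
  by rewrite -[RHS]e; ring.
by rewrite mulf_eq0; nia.
Qed.

Lemma lie_blockLE (R : realType) q x y z (k : int) :
  block_coef q x y = k -> block_add x y = z ->
  lie (blockL R q x) (blockL R q y) = k%:~R *: blockL R q z.
Proof. by move=> <- <-; exact: block_bracketL. Qed.

(** [mcoeffZ] for the scaling of blockLie itself, so that rewriting does not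
    have to compare it with the one of {malg R[i][_]}. *)
Lemma block_coefZ (R : realType) q c (v : blockLie R q) x :
  (c *: v)@_x = c * v@_x.
Proof. exact: mcoeffZ. Qed.

Lemma malg_neq0 (R : realType) (q : nat) (v : blockLie R q) :
  v != 0 -> exists x, v@_x != 0.
Proof.
move=> v0; have /fset0Pn[x] : msupp v != fset0.
  apply: contraNneq v0 => e; apply/eqP/malgP => x.
  by rewrite mcoeff0 mcoeff_outdom // e inE.
by rewrite -mcoeff_neq0; exists x.
Qed.

Lemma lieZl (K : fieldType) (V : lieAlgType K) c (u v : V) :
  lie (c *: u) v = c *: lie u v.
Proof. exact: (GRing.scalable_linear (lie_linearl v)). Qed.

Section Iso.
Variables (R : realType) (q1 q2 : nat).
Variable f : {linear blockLie R q1 -> blockLie R q2}.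
Hypotheses (q1_gt0 : (0 < q1)%N) (q2_gt0 : (0 < q2)%N).
Hypothesis f_bij : bijective f.
Hypothesis f_lie : {morph f : u v / lie u v}.

Let f0 u : u != 0 -> f u != 0.
Proof.
by apply: contra_neq => e; apply: (bij_inj f_bij); rewrite e linear0.
Qed.

Let fZ c u : f (c *: u) = c *: f u.
Proof. exact: linearZ. Qed.

Let rowZ b c (p : {poly R[i]}) : row q2 b (c *: p) = c *: row q2 b p.
Proof. exact: linearZ. Qed.

Let eulerZ m c (p : {poly R[i]}) : euler m (c *: p) = c *: euler m p.
Proof. exact: linearZ. Qed.

Let row0 b : row q2 b (0 : {poly R[i]}) = 0.
Proof. exact: linear0. Qed.

(** Local finiteness of ad L_{0,0} is transported by f, and only multiples of
    L_{0,0} have it. *)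
Lemma iso_L00 : exists c, f (blockL R q1 (0, 0%N)) = c *: blockL R q2 (0, 0%N).
Proof.
have [g gf fg] := f_bij; set e := blockL R q1 _.
have fin v : exists l, ad_prod (f e) l v = 0.
  have [l hl] := ad_locally_finite00 (g v); exists l.
  rewrite -[v]fg; suff -> : ad_prod (f e) l (f (g v)) = f (ad_prod e l (g v)).
    by rewrite hl linear0.
  by elim: l {hl} => //= k l ->; rewrite linearB [f (k *: _)]linearZ /= f_lie.
exists (f e)@_(0, 0%N); apply/malgP => z; rewrite mcoeffZ mcoeffU.
have [<-|z0] := eqVneq (0, 0%N) z; first by rewrite mulr1.
by rewrite mulr0 (ad_locally_finite_supp q2_gt0 fin) // eq_sym.
Qed.

(** f intertwines ad L_{0,0} with c times ad L_{0,0}, hence maps eigenvectors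
    to eigenvectors.  The eigenvalue of L_{1,0} determines b. *)
Lemma iso_graded : exists c b, [/\ c * b%:~R * q2%:R = q1%:R :> R[i],
  f (blockL R q1 (0, 0%N)) = c *: row q2 0 1 &
  forall a i, exists p, f (blockL R q1 (a, i)) = row q2 (a * b) p].
Proof.
have [c fc] := iso_L00.
have eig a i x : c * x.1%:~R * q2%:R * (f (blockL R q1 (a, i)))@_x =
    a%:~R * q1%:R * (f (blockL R q1 (a, i)))@_x.
  have e : (a * q1%:Z)%:~R *: f (blockL R q1 (a, i)) =
      c *: lie (blockL R q2 (0, 0%N)) (f (blockL R q1 (a, i))).
    rewrite -lieZl -fc -f_lie -fZ; congr (f _); symmetry.
    by apply: lie_blockLE; rewrite /block_coef /block_add /= ?add0r //; lia.
  transitivity (c *: lie (blockL R q2 (0, 0%N)) (f (blockL R q1 (a, i))))@_x.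
    by rewrite block_coefZ lie00_coef intrM !mulrA.
  by rewrite -e block_coefZ intrM.
have [x fx] : exists x, (f (blockL R q1 (1, 0%N)))@_x != 0.
  apply: malg_neq0; apply: f0; apply/eqP => /(congr1 (mcoeff (1, 0%N)))/eqP.
  by rewrite mcoeffUU mcoeff0 oner_eq0.
have cb : c * x.1%:~R * q2%:R = q1%:R.
  by apply: (mulIf fx); rewrite eig mul1r.
have : (c * q2%:R : R[i]) != 0.
  have: (q1%:R : R[i]) != 0 by rewrite pnatr_eq0 -lt0n.
  by apply: contra_neq => e; rewrite -cb mulrAC e mul0r.
move=> cq; exists c, x.1; split=> [| |a i]; first exact: cb.
  by rewrite fc -[1]/('X^0) rowXn.
apply: row_of => y ya; apply: contraNeq ya => fy.
have := mulIf fy (eig a i y); rewrite -cb mulrAC.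
have -> : a%:~R * (c * x.1%:~R * q2%:R) = c * q2%:R * (a * x.1)%:~R.
  by rewrite intrM; ring.
by move/(mulfI cq)/intr_inj ->.
Qed.

(** The quotient q2 / q1 is an exponent d that occurs in the polynomial u of
    f L_{0,1}. *)
Lemma iso_dvdn : (q1 %| q2)%N.
Proof.
have [c [b [cb f00 fr]]] := iso_graded.
have [g fg] := fr 1 0%N; rewrite mul1r in fg.
have [h fh] := fr (- 1) 0%N; rewrite mulN1r in fh.
have [u fu] := fr 0 1%N; rewrite mul0r in fu.
have bq1 : (q1%:R : R[i]) != 0 by rewrite pnatr_eq0 -lt0n.
have b0 : (b%:~R : R[i]) != 0.
  by apply: contraNneq bq1 => e; rewrite -cb e mulr0 mul0r.
(* The image under f of [L_{1,0}, L_{-1,0}] = - 2 q1 L_{0,0}. *)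
have egh : b%:~R *: euler (q2 + q2) (g * h) = (q1 + q1)%:R *: (c%:P).
  have e : lie (blockL R q1 (1, 0%N)) (blockL R q1 (- 1, 0%N)) =
      (- (q1 + q1)%:Z)%:~R *: blockL R q1 (0, 0%N).
    by apply: lie_blockLE; rewrite // /block_coef /=; lia.
  have := f_lie (blockL R q1 (1, 0%N)) (blockL R q1 (- 1, 0%N)).
  rewrite e fZ f00 fg fh lie_row_opp scalerA -rowZ => /row_inj /esym.
  rewrite rmorphN mulNr !scaleNr => /oppr_inj ->.
  by rewrite -alg_polyC scalerA.
(* E + 2 q2 multiplies each 'X^i by a nonzero scalar. *)
have [k ghk] : exists k, g * h = k%:P.
  exists (g * h)`_0; apply/polyP => -[|i]; rewrite coefC //=.
  apply/eqP; have /eqP := congr1 (fun p : {poly _} => p`_i.+1) egh.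
  rewrite !coefZ coef_euler coefC /= mulr0 !mulf_eq0 (negPf b0) pnatr_eq0.
  by rewrite addSn.
have bk : b%:~R ^+ 2 * k * q2%:R ^+ 2 = q1%:R ^+ 2.
  have := congr1 (fun p : {poly _} => p`_0) egh.
  rewrite ghk !coefZ coef_euler !coefC /= add0n !natrD => e.
  have {}e : b%:~R * q2%:R * k = q1%:R * c.
    have two0 : (2%:R : R[i]) != 0 by rewrite pnatr_eq0.
    apply: (mulfI two0); transitivity (b%:~R * ((q2%:R + q2%:R) * k)).
      by ring.
    by rewrite e; ring.
  transitivity (q1%:R * (c * b%:~R * q2%:R)); last by rewrite cb expr2.
  transitivity (b%:~R * q2%:R * k * (b%:~R * q2%:R)); first by ring.
  by rewrite e; ring.
(* The image under f of the bracket of [L_{0,1}, L_{1,0}] with L_{-1,0}. *)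
have eu : (b%:~R ^+ 2 * k) *: euler (q2 + q2) (euler q2 u) =
    ((1 + q1) * (1 + 2 * q1))%:R *: u.
  have e1 : lie (blockL R q1 (0, 1%N)) (blockL R q1 (1, 0%N)) =
      (1 + q1)%:Z%:~R *: blockL R q1 (1, 1%N).
    by apply: lie_blockLE; rewrite // /block_coef /=; lia.
  have e2 : lie (blockL R q1 (1, 1%N)) (blockL R q1 (- 1, 0%N)) =
      (- (1 + 2 * q1)%:Z)%:~R *: blockL R q1 (0, 1%N).
    by apply: lie_blockLE; rewrite // /block_coef /=; lia.
  have := f_lie (lie (blockL R q1 (0, 1%N)) (blockL R q1 (1, 0%N)))
                 (blockL R q1 (- 1, 0%N)).
  rewrite [in RHS]f_lie fu fg fh lie_row0 lie_row_opp.
  rewrite e1 lieZl e2 !fZ fu scalerA.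
  rewrite -rowZ => /row_inj.
  rewrite -scalerAl -mulrA ghk [_ * k%:P]mulrC mul_polyC !eulerZ !scalerA => e.
  have -> : b%:~R ^+ 2 * k = - (- b%:~R * (b%:~R * k)) by ring.
  by rewrite scaleNr -e -scaleNr rmorphN mulrN opprK natrM.
have u0 : u != 0.
  have : f (blockL R q1 (0, 1%N)) != 0.
    apply: f0; apply/eqP => /(congr1 (mcoeff (0, 1%N)))/eqP.
    by rewrite mcoeffUU mcoeff0 oner_eq0.
  by apply: contra_neq => e; rewrite fu e row0.
pose d := (size u).-1; have ud : u`_d != 0 by rewrite -lead_coef_eq0 in u0.
apply/dvdnP; exists d; symmetry; apply: ratio_unique => //.
have := congr1 (fun p : {poly _} => p`_d) eu.
rewrite !coefZ !coef_euler !mulrA => /(mulIf ud) {}eu.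
apply/eqP; rewrite -(eqr_nat R[i]); apply/eqP.
rewrite [in RHS]natrM -eu natrM !natrX -bk addnn -mul2n natrM.
by ring.
Qed.

End Iso.

Lemma lie_isomorphic_sym (K : fieldType) (U V : lieAlgType K) :
  lie_isomorphic U V -> lie_isomorphic V U.
Proof.
move=> [f [[g fK gK] f_lie]].
pose gL : {linear V -> U} :=
  HB.pack g (GRing.isLinear.Build K V U *:%R g (can2_linear fK gK)).
exists gL; split; first by exists f.
by move=> u v; apply: (can_inj fK); rewrite f_lie !gK.
Qed.

Theorem theorem1p1 (R : realType) (q1 q2 : nat) (hq1 : (0 < q1)%N)
  (hq2 : (0 < q2)%N) :
  lie_isomorphic (blockLie R q1) (blockLie R q2) <-> q1 = q2.
Proof.
split=> [iso12|->].
  have [f [f_bij f_lie]] := iso12.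
  have [g [g_bij g_lie]] := lie_isomorphic_sym iso12.
  apply/eqP; rewrite eqn_dvd (iso_dvdn hq1 hq2 f_bij f_lie).
  exact: iso_dvdn hq2 hq1 g_bij g_lie.
exists idfun; split; last by [].
by exists idfun.
Qed.
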